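(* For every $k\in\mathcal K$, consider the mixed-integer program $\mathcal M_k^{\mathrm{Alexa}}$ in the variables $P\in\mathcal F$, $\pi=(\pi_{a,t,r})$, $L=(L_r)$: minimize $L_k$ subject to (1) $\sum_{r\in\mathcal K}\pi_{a,t,r}=1$ for all $(a,t)\in\mathcal A_T$; (2) $\sum_{(a,t)\in\mathcal A_T}\pi_{a,t,r}=1$ for all $r\in\mathcal K$; (3) $L_r-\lambda(a,t;P)\le M(1-\pi_{a,t,r})$ and $\lambda(a,t;P)-L_r\le M(1-\pi_{a,t,r})$ for all $(a,t)\in\mathcal A_T$, $r\in\mathcal K$; (4) $L_{r-1}\ge L_r$ for $r=2,\dots,N$; (5) $L_j=\bar\lambda_j$ for $j=1,\dots,k-1$; (6) $\pi_{a,t,r}\in\{0,1\}$, $L_r\ge 0$ for all $(a,t)\in\mathcal A_T$, $r\in\mathcal K$; where $M=\max_{(a,t)\in\mathcal A_T}\frac{\mathrm{maxSeg}}{c(a)}\bigl(\max_{i\ne j}r(i,j,a,t)\bigr)\sum_{d\in D}\nu(d,t)$. Then the optimal value of $\mathcal M_k^{\mathrm{Alexa}}$ is $\bar\lambda_k=\min_{P\in\mathcal F_{k-1}}\lambda^{\downarrow}_k(P)$, and the routing scheme $P^\star_k$ read from any optimal solution belongs to $\mathcal F_k$.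
   Context: Setting ($T$-ASR instance). $G=(V,A)$ is a finite directed graph with arc weights $\omega:A\to\mathbb Q_{>0}$ and capacities $c:A\to\mathbb Q_{>0}$. $T=\{0,\dots,h-1\}$ with $h\ge1$, $T^*=T\setminus\{0\}$. $q:T\to2^A$ with $q(0)=\varnothing$ gives the unavailable arcs, $G_t=(V,A\setminus q(t))$. $\mathcal A_T=\{(a,t):t\in T,\ a\in A\setminus q(t)\}$, $N=|\mathcal A_T|$, $\mathcal K=\{1,\dots,N\}$. $D$ is a finite set of demands; demand $d$ has source $s_d\in V$ and target $t_d\in V$. $\nu:D\times T\to\mathbb Q_{\ge0}$ are traffic volumes, $\kappa:T^*\to\mathbb N$ reconfiguration budgets, $\mathrm{maxSeg}\ge2$ an integer. Split coefficients: the forwarding graph from $u$ to $v$ at time $t$ consists of the arcs of $G_t$ lying on $\omega$-shortest $u$–$v$ paths in $G_t$. $r(u,v,a,t)\ge0$ is the fraction of a unit flow from $u$ to $v$ that uses arc $a$ when the flow entering each vertex is split equally among its outgoing arcs in this forwarding graph; $r(u,v,a,t)=0$ if $a$ is not in it. Segment paths: a segment valid at $t$ is a pair $(i,j)$, $i\ne j$, with $j$ reachable from $i$ in $G_t$. A segment path of $d$ at $t$ is a node sequence $\langle s_d=v_0,v_1,\dots,v_m=t_d\rangle$, $1\le m\le\mathrm{maxSeg}$, whose segments $(v_{l-1},v_l)$ are valid at $t$ and pairwise distinct (nodes may repeat). $\delta(p,ij)=1$ if $p$ contains segment $(i,j)$, else $0$. $\operatorname{dist}(p,p')=\sum_{i\ne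 j}|\delta(p,ij)-\delta(p',ij)|$. $\mathcal F$ is the set of routing schemes $P=(p_d^t)_{d\in D,t\in T}$ ($p_d^t$ a segment path of $d$ at $t$) with $\sum_{d\in D}\operatorname{dist}(p_d^{t-1},p_d^{t})\le\kappa(t)$ for all $t\in T^*$; $\mathcal F$ is assumed non-empty (it is finite). Loads: $\lambda(a,t;P)=\frac1{c(a)}\sum_{d\in D}\sum_{i,j}r(i,j,a,t)\,\nu(d,t)\,\delta(p_d^t,ij)$ for $(a,t)\in\mathcal A_T$; $\lambda^{\downarrow}(P)=(\lambda^{\downarrow}_1(P)\ge\dots\ge\lambda^{\downarrow}_N(P))$ is the load vector sorted in non-increasing order. Recursion: $\mathcal F_0=\mathcal F$ and, for $k\ge1$, $\bar\lambda_k=\min_{P\in\mathcal F_{k-1}}\lambda^{\downarrow}_k(P)$, $\mathcal F_k=\{P\in\mathcal F_{k-1}:\lambda^{\downarrow}_k(P)=\bar\lambda_k\}$. *)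

(* Defs.v *)
From HB Require Import structures.
From mathcomp Require Import all_boot all_order all_algebra.
From mathcomp Require Import boolp.

Set Implicit Arguments.
Unset Strict Implicit.
Unset Printing Implicit Defensive.

Import Order.TTheory GRing.Theory Num.Theory.

Local Open Scope ring_scope.

(* Arcs are an abstract finite type with end points, so parallel arcs and     *)
(* loops are allowed; a digraph with A included in V * V is the case where    *)
(* arc is the corresponding subtype of V * V.                                 *)
(* T = {0, .., h-1} is 'I_horizon; the budget at time 0 is never used.        *)
Record asr_instance := AsrInstance {
  vertex : finType;
  arc : finType;
  src : arc -> vertex;
  dst : arc -> vertex;
  weight : arc -> rat;
  capacity : arc -> rat;
  horizon : nat;
  unavailable : 'I_horizon -> {set arc};
  demand : finType;
  source : demand -> vertex;
  target : demand -> vertex;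
  volume : demand -> 'I_horizon -> rat;
  budget : 'I_horizon -> nat;
  maxSeg : nat;
  weight_gt0 : forall a, 0 < weight a;
  capacity_gt0 : forall a, 0 < capacity a;
  horizon_gt0 : (0 < horizon)%N;
  unavailable0 : forall t : 'I_horizon, t = 0%N :> nat -> unavailable t = set0;
  volume_ge0 : forall d t, 0 <= volume d t;
  maxSeg_ge2 : (2 <= maxSeg)%N
}.

Arguments src {a0}.
Arguments dst {a0}.
Arguments weight {a0}.
Arguments capacity {a0}.
Arguments unavailable {a0}.
Arguments source {a0}.
Arguments target {a0}.
Arguments volume {a0}.
Arguments budget {a0}.

Notation time I := 'I_(horizon I).

Definition arc_times (I : asr_instance) : {set arc I * time I} :=
  [set x | x.1 \notin unavailable x.2].

Definition num_arc_times (I : asr_instance) : nat := #|arc_times I|.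

(* A rank r in {1, .., N} is represented by the ordinal of value r - 1.       *)
Notation rank I := 'I_(num_arc_times I).

Fixpoint walk (I : asr_instance) (t : time I) (u v : vertex I)
    (p : seq (arc I)) : bool :=
  if p is a :: p' then
    [&& a \notin unavailable t, src a == u & walk t (dst a) v p']
  else u == v.

Definition length_of (I : asr_instance) (p : seq (arc I)) : rat :=
  \sum_(a <- p) weight a.

(* Since weights are positive, a walk that is shortest among all walks visits *)
(* no vertex twice (see shortest_uniq below), so minimizing over walks or     *)
(* over simple paths yields the same shortest paths.                          *)
Definition shortest (I : asr_instance) (t : time I) (u v : vertex I)
    (p : seq (arc I)) : Prop :=
  walk t u v p /\ forall p', walk t u v p' -> length_of p <= length_of p'.

Definition forwarding (I : asr_instance) (t : time I) (u v : vertex I) :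
    {set arc I} :=
  [set a | `[< exists2 p, shortest t u v p & a \in p >]].

Definition fwd_degree (I : asr_instance) (t : time I) (u v w : vertex I) : nat :=
  #|[set a in forwarding t u v | src a == w]|.

(* The part of the unit flow from u to v that reaches w after exactly n arcs. *)
Fixpoint mass (I : asr_instance) (t : time I) (u v : vertex I) (n : nat)
    (w : vertex I) : rat :=
  if n is n'.+1 then
    \sum_(a in forwarding t u v | dst a == w)
      mass t u v n' (src a) / (fwd_degree t u v (src a))%:R
  else (w == u)%:R.

(* The forwarding graph is acyclic, so no mass is left after #|V| steps.      *)
Definition inflow (I : asr_instance) (t : time I) (u v w : vertex I) : rat :=
  \sum_(n < #|vertex I|) mass t u v n w.

(* split_coefE below is the equal-split flow equation, which      *)
(* determines r on the acyclic forwarding graph.                              *)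
Definition split_coef (I : asr_instance) (u v : vertex I) (a : arc I)
    (t : time I) : rat :=
  if a \in forwarding t u v then
    inflow t u v (src a) / (fwd_degree t u v (src a))%:R
  else 0.

Definition adjacent (I : asr_instance) (t : time I) : rel (vertex I) :=
  fun i j => [exists a, [&& a \notin unavailable t, src a == i & dst a == j]].

Definition valid_segment (I : asr_instance) (t : time I)
    (s : vertex I * vertex I) : bool :=
  (s.1 != s.2) && connect (adjacent t) s.1 s.2.

Definition segments (V : Type) (p : seq V) : seq (V * V) := zip p (behead p).

Definition segment_path (I : asr_instance) (d : demand I) (t : time I)
    (p : seq (vertex I)) : bool :=
  if p is v0 :: p' then
    [&& v0 == source d, last v0 p' == target d,
        (1 <= size p' <= maxSeg I)%N,
        all (valid_segment t) (segments p) & uniq (segments p)]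
  else false.

Definition delta (V : eqType) (p : seq V) (i j : V) : nat :=
  (i, j) \in segments p.

Definition sp_dist (V : finType) (p p' : seq V) : nat :=
  (\sum_(i : V) \sum_(j : V | i != j)
     `|(delta p i j)%:Z - (delta p' i j)%:Z|)%N.

(* Segment paths have at most maxSeg + 1 nodes; bounded sequences make the    *)
(* set of candidate schemes a finite type.                                    *)
Notation scheme I :=
  {ffun demand I * time I -> (maxSeg I).+1.-bseq (vertex I)}.

Definition schemes (I : asr_instance) : {set scheme I} :=
  [set P : scheme I |
    [forall d, forall t, segment_path d t (P (d, t))] &&
    [forall t : time I, forall t' : time I, (t' == t.+1 :> nat) ==>
      (\sum_(d : demand I) sp_dist (P (d, t)) (P (d, t')) <= budget t')%N]].

Definition load (I : asr_instance) (P : scheme I) (x : arc I * time I) : rat :=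
  (capacity x.1)^-1 *
  \sum_(d : demand I) \sum_(i : vertex I) \sum_(j : vertex I)
    split_coef i j x.1 x.2 * volume d x.2 * (delta (P (d, x.2)) i j)%:R.

(* sorted_load k P is the (k+1)-st largest load.                              *)
Definition sorted_load (I : asr_instance) (k : nat) (P : scheme I) : rat :=
  nth 0 (sort >=%O [seq load P x | x <- enum (arc_times I)]) k.

Definition min_over (T : finType) (S : {set T}) (f : T -> rat) : rat :=
  if [pick P in S] is Some P0 then f [arg min_(P < P0 in S) f P]%O else 0.

(* lex_schemes I k consists of the schemes whose k largest loads have been    *)
(* minimized successively.                                                    *)
Fixpoint lex_schemes (I : asr_instance) (k : nat) : {set scheme I} :=
  if k is k'.+1 then
    [set P in lex_schemes I k' |
      sorted_load k' P == min_over (lex_schemes I k') (sorted_load k')]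
  else schemes I.

(* lex_load k is the optimal load of rank k + 1, i.e. the minimum over       *)
(* lex_schemes I k of the (k+1)-st largest load.                              *)
Definition lex_load (I : asr_instance) (k : nat) : rat :=
  min_over (lex_schemes I k) (@sorted_load I k).

(* All terms are nonnegative, so the default value 0 of the iterated maxima   *)
(* only matters when the index set is empty.                                  *)
Definition bigM (I : asr_instance) : rat :=
  \big[Num.max/0]_(x in arc_times I)
    ((maxSeg I)%:R / capacity x.1 *
     (\big[Num.max/0]_(ij : vertex I * vertex I | ij.1 != ij.2)
        split_coef ij.1 ij.2 x.1 x.2) *
     \sum_(d : demand I) volume d x.2).

(* The continuous variables range over an ordered field R (e.g. the reals),   *)
(* into which the rational data are embedded by ratr.  The values of pi_var   *)
(* outside arc_times I occur nowhere in the program.                          *)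
Record mip_point (I : asr_instance) (R : realFieldType) := MipPoint {
  scheme_var : scheme I;
  pi_var : arc I * time I -> rank I -> R;
  L_var : rank I -> R
}.

Record feasible (I : asr_instance) (R : realFieldType) (k : rank I)
    (s : mip_point I R) : Prop := Feasible {
  scheme_ok : scheme_var s \in schemes I;
  one_rank : forall x, x \in arc_times I -> \sum_(r : rank I) pi_var s x r = 1;
  one_arc : forall r, \sum_(x in arc_times I) pi_var s x r = 1;
  L_le : forall x r, x \in arc_times I ->
    L_var s r - ratr (load (scheme_var s) x)
      <= ratr (bigM I) * (1 - pi_var s x r);
  L_ge : forall x r, x \in arc_times I ->
    ratr (load (scheme_var s) x) - L_var s r
      <= ratr (bigM I) * (1 - pi_var s x r);
  L_sorted : forall r r' : rank I, r' = r.+1 :> nat -> L_var s r' <= L_var s r;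
  L_fixed : forall j : rank I, (j < k)%N -> L_var s j = ratr (lex_load I j);
  pi_binary : forall x r, x \in arc_times I ->
    pi_var s x r = 0 \/ pi_var s x r = 1;
  L_ge0 : forall r, 0 <= L_var s r
}.

Definition optimal (I : asr_instance) (R : realFieldType) (k : rank I)
    (s : mip_point I R) : Prop :=
  feasible k s /\ forall s', feasible k s' -> L_var s k <= L_var s' k.

Definition optimal_value (I : asr_instance) (R : realFieldType) (k : rank I)
    (v : R) : Prop :=
  exists2 s : mip_point I R, optimal k s & L_var s k = v.

Lemma min_overP (T : finType) (S : {set T}) (f : T -> rat) :
  S != set0 ->
  (exists2 P, P \in S & f P = min_over S f) /\
  (forall P, P \in S -> min_over S f <= f P).
Proof.
case/set0Pn=> P0 P0S; rewrite /min_over; case: pickP => [P1 P1S|/(_ P0)];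
  last by rewrite P0S.
case: arg_minP => //= P PS Pmin; split; first by exists P.
by move=> Q QS; apply: Pmin.
Qed.

Lemma walk_cat (I : asr_instance) (t : time I) (u v w : vertex I) p1 p2 :
  walk t u w p1 -> walk t w v p2 -> walk t u v (p1 ++ p2).
Proof.
elim: p1 u => [|a p IH] u /=; first by move/eqP->.
by case/and3P=> -> -> /IH H /H ->.
Qed.

Lemma walk_catP (I : asr_instance) (t : time I) (u v : vertex I) p1 p2 :
  walk t u v (p1 ++ p2) -> exists2 w, walk t u w p1 & walk t w v p2.
Proof.
elim: p1 u => [|a p IH] u /=; first by exists u.
by case/and3P=> -> -> /IH [w w1 w2]; exists w.
Qed.

Lemma length_of_cat (I : asr_instance) (p1 p2 : seq (arc I)) :
  length_of (p1 ++ p2) = length_of p1 + length_of p2.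
Proof. by rewrite /length_of big_cat. Qed.

Lemma length_of_cons (I : asr_instance) (a : arc I) p :
  length_of (a :: p) = weight a + length_of p.
Proof. by rewrite /length_of big_cons. Qed.

Lemma length_of_ge0 (I : asr_instance) (p : seq (arc I)) : 0 <= length_of p.
Proof. by apply: sumr_ge0 => a _; apply: ltW (weight_gt0 a). Qed.

Lemma shortest_suffix (I : asr_instance) (t : time I) (u v w : vertex I) p1 p2 :
  walk t u w p1 -> walk t w v p2 -> shortest t u v (p1 ++ p2) ->
  shortest t w v p2.
Proof.
move=> w1 w2 [_ min]; split=> // p' w'.
by have := min _ (walk_cat w1 w'); rewrite !length_of_cat lerD2l.
Qed.

Lemma walk_mem (I : asr_instance) (t : time I) (u v x : vertex I) p :
  walk t u v p -> x \in [seq dst a | a <- p] ->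
  exists p1 p2, [/\ p = p1 ++ p2, p1 != [::], walk t u x p1 & walk t x v p2].
Proof.
elim: p u => [|a p IH] u //= /and3P[ha hu hp]; rewrite inE => /orP[/eqP ->|xp].
  by exists [:: a], p; rewrite /= ha hu eqxx.
have [p1 [p2 [-> _ w1 w2]]] := IH _ hp xp.
by exists (a :: p1), p2; rewrite /= ha hu.
Qed.

Lemma shortest_uniq (I : asr_instance) (t : time I) (u v : vertex I) p :
  shortest t u v p -> uniq (u :: [seq dst a | a <- p]).
Proof.
elim: p u => [|a p IH] u // sp.
have [/= /and3P[ha hu hp] min] := sp.
have /IH/= -> : shortest t (dst a) v p.
  by apply: (@shortest_suffix _ _ u _ _ [:: a]) => //=; rewrite ha hu eqxx.
rewrite andbT; apply/negP=> /(@walk_mem _ t u v u (a :: p)).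
rewrite /= ha hu => /(_ hp) [[|b p1] [p2 [e q0 _ w2]]] //.
have := min _ w2; rewrite e length_of_cat length_of_cons.
rewrite gerDr.
rewrite leNgt; case/negP.
by apply: (lt_le_trans (weight_gt0 b)); rewrite lerDl length_of_ge0.
Qed.

Lemma mass_walk (I : asr_instance) (t : time I) (u v w : vertex I) (n : nat) :
  forwarding t u v != set0 -> mass t u v n w != 0 ->
  exists p1 p2, [/\ size p1 = n, walk t u w p1, walk t w v p2 &
                    shortest t u v (p1 ++ p2)].
Proof.
move=> /set0Pn[a0]; rewrite inE => /asboolP[p0 sp0 _].
elim: n w => [|n IH] w /=.
  case: (eqVneq w u) => [->|_]; last by rewrite eqxx.
  by move=> _; exists [::], p0; split=> //=; case: sp0.
move=> nz; have [a /andP[aF /eqP <-] az] : exists2 a,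
    (a \in forwarding t u v) && (dst a == w) & mass t u v n (src a) != 0.
  apply/exists_inP; apply: contraNT nz; rewrite negb_exists_in.
  move=> /forall_inP H; apply/eqP; apply: big1 => a /H.
  by rewrite negbK => /eqP ->; rewrite mul0r.
have [p1 [p2 [sz w1 w2 sp]]] := IH _ az.
move: aF; rewrite inE => /asboolP[p sp' ap].
move: ap sp'; case/splitPr => q1 q2 [wq minq].
have [x x1] := walk_catP wq; rewrite /= => /and3P[ha /eqP hx x2].
rewrite -{}hx in x1.
exists (rcons p1 a), q2; rewrite size_rcons sz; split=> //.
  by rewrite -cats1; apply: walk_cat w1 _; rewrite /= ha !eqxx.
have wa : walk t u v (p1 ++ a :: q2).
  by apply: walk_cat w1 _; rewrite /= ha eqxx.
rewrite cat_rcons; split=> // p' wp'.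
apply: le_trans (sp.2 _ wp'); rewrite !length_of_cat lerD2l.
by have := minq _ (walk_cat x1 w2); rewrite !length_of_cat lerD2l.
Qed.

Lemma mass_eq0 (I : asr_instance) (t : time I) (u v w : vertex I) :
  forwarding t u v != set0 -> mass t u v #|vertex I| w = 0.
Proof.
move=> F0; apply/eqP; apply: contraT => /(mass_walk F0) [p1 [p2 [sz _ _ sp]]].
have /card_uniqP e := shortest_uniq sp.
have := max_card (mem (u :: [seq dst a | a <- p1 ++ p2])).
by rewrite e /= size_map size_cat sz -addSn leqNgt ltnS leq_addr.
Qed.

Lemma split_coefE (I : asr_instance) (t : time I) (u v : vertex I) (a : arc I) :
  a \in forwarding t u v ->
  split_coef u v a t =
    ((src a == u)%:R
       + \sum_(b in forwarding t u v | dst b == src a) split_coef u v b t)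
    / (fwd_degree t u v (src a))%:R.
Proof.
move=> aF; have F0 : forwarding t u v != set0 by apply/set0Pn; exists a.
rewrite {1}/split_coef aF; congr (_ / _).
transitivity (\sum_(n < #|vertex I|.+1) mass t u v n (src a)).
  by rewrite big_ord_recr /= mass_eq0 // addr0.
rewrite big_ord_recl /=; congr (_ + _).
rewrite exchange_big /=; apply: eq_bigr => b /andP[bF _].
by rewrite /split_coef bF /inflow mulr_suml.
Qed.

(* Main.v *)
Require Import Defs.
From mathcomp Require Import all_boot all_order all_algebra.
From mathcomp Require Import ring lra.

Set Implicit Arguments.
Unset Strict Implicit.
Unset Printing Implicit Defensive.

Import Order.TTheory GRing.Theory Num.Theory.

Local Open Scope ring_scope.

(* The assignment constraints make the binary matrix pi a bijection between   *)
(* ranks and arc-time pairs, and where pi = 1 the big-M constraints force     *)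
(* L_r to be the load of the assigned pair.  As L is non-increasing, it is    *)
(* the sorted load vector of the scheme.  Conversely every scheme extends to  *)
(* a feasible point as M bounds all loads: a segment path has at most maxSeg  *)
(* segments.  Hence the constraints L_j = lex_load j say that the scheme is   *)
(* in lex_schemes k, and L_k is its k-th sorted load.                         *)

(** The projection of the feasible set onto schemes is exactly [lex_schemes I k], by
    [feasible_lex_schemes] and [feasible_sorted_point], and by [feasible_L] the objective depends on
    the scheme alone. The program thus minimizes [sorted_load k] over [lex_schemes I k], whose
    minimum is [lex_load I k] by definition. *)

Lemma sum01_eq1_exists (R : numDomainType) (T : finType) (A : {pred T})
    (f : T -> R) :
  (forall x, x \in A -> f x = 0 \/ f x = 1) -> \sum_(x in A) f x = 1 ->
  exists2 x, x \in A & f x = 1.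
Proof.
move=> f01 sum1; have [/exists_inP[x xA /eqP]|none] :=
  boolP [exists x in A, f x == 1]; first by exists x.
have f0 x : x \in A -> f x = 0.
  move=> xA; case: (f01 x xA) => // fx1.
  by case/exists_inP: none; exists x; rewrite ?fx1.
by have := oner_neq0 R; rewrite -sum1 big1 ?eqxx.
Qed.

Lemma sum01_eq1_unique (R : numDomainType) (T : finType) (f : T -> R) x y :
  (forall z, f z = 0 \/ f z = 1) -> \sum_z f z = 1 ->
  f x = 1 -> f y = 1 -> x = y.
Proof.
move=> f01 sum1 fx fy; apply/eqP; apply: contraT => xy.
have := sum1; rewrite (bigD1 x) //= fx -[RHS]addr0 => /addrI/eqP.
rewrite psumr_eq0 => [|z _]; last by case: (f01 z) => ->.
by move/allP/(_ y (mem_index_enum _)); rewrite eq_sym xy fy oner_eq0.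
Qed.

Section Loads.
Variable I : asr_instance.
Implicit Types (P : scheme I) (x : Defs.arc I * time I).

Lemma mass_ge0 (t : time I) u v n w : 0 <= mass t u v n w.
Proof.
elim: n w => [|n IH] w /=; first exact: ler0n.
by apply: sumr_ge0 => a _; rewrite divr_ge0.
Qed.

Lemma split_coef_ge0 (t : time I) u v a : 0 <= split_coef u v a t.
Proof.
rewrite /split_coef; case: ifP => // _; rewrite divr_ge0 //.
by apply: sumr_ge0 => n _; apply: mass_ge0.
Qed.

Lemma load_ge0 P x : 0 <= load P x.
Proof.
rewrite /load mulr_ge0 ?invr_ge0 ?(ltW (capacity_gt0 _)) //.
do 3![apply: sumr_ge0 => ? _].
by rewrite !mulr_ge0 ?split_coef_ge0 ?volume_ge0.
Qed.

(** Segments of a path are pairwise distinct, so the double sum visits each of the at most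
    [maxSeg I] segments once. Valid segments have distinct ends, hence a bound off the diagonal
    suffices. *)
Lemma segment_sum_le d t (p : seq (vertex I)) (f : vertex I * vertex I -> rat) (m : rat) :
  segment_path d t p -> 0 <= m -> (forall ij, ij.1 != ij.2 -> f ij <= m) ->
  \sum_i \sum_j f (i, j) * (delta p i j)%:R <= (maxSeg I)%:R * m.
Proof.
case: p => // v0 p' /and5P[_ _ /andP[_ size_p] /allP valid uniq_seg] m0 fm.
rewrite pair_big /=.
have -> : \sum_ij f (ij.1, ij.2) * (delta (v0 :: p') ij.1 ij.2)%:R =
          \sum_(ij <- segments (v0 :: p')) f ij.
  rewrite (big_uniq _ uniq_seg) [RHS]big_mkcond; apply: eq_bigr => -[i j] _ /=.
  by rewrite /delta; case: (_ \in _); rewrite ?mulr1 ?mulr0.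
apply: (@le_trans _ _ (\sum_(ij <- segments (v0 :: p')) m)).
  by rewrite big_seq [leRHS]big_seq ler_sum // => ij /valid/andP[/fm].
rewrite big_const_seq count_predT iter_addr_0 -[leLHS]mulr_natl ler_wpM2r // ler_nat.
by rewrite size_zip /= (leq_trans (geq_minr _ _)).
Qed.

Lemma load_le_bigM P x :
  P \in schemes I -> x \in arc_times I -> load P x <= bigM I.
Proof.
rewrite inE => /andP[/forallP pathP _] xA.
pose m : rat := \big[Num.max/0]_(ij : vertex I * vertex I | ij.1 != ij.2)
  split_coef ij.1 ij.2 x.1 x.2.
have m0 : 0 <= m by apply: bigmax_ge_id.
apply: le_trans (le_bigmax_cond _ _ xA).
(* Factored this way, the bound is compared demand by demand with the load. *)
rewrite /load -/m [leRHS](_ : _ = (capacity x.1)^-1 *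
  ((\sum_d volume d x.2) * ((maxSeg I)%:R * m))); last by ring.
rewrite ler_wpM2l ?invr_ge0 ?(ltW (capacity_gt0 _)) //.
rewrite mulr_suml ler_sum // => d _.
rewrite [leLHS](_ : _ = volume d x.2 * \sum_i \sum_j
    split_coef i j x.1 x.2 * (delta (P (d, x.2)) i j)%:R).
  rewrite ler_wpM2l ?volume_ge0 //.
  apply: (segment_sum_le (f := fun ij => split_coef ij.1 ij.2 x.1 x.2)
    (forallP (pathP d) x.2)) => // ij ijD.
  exact: (le_bigmax_cond _ (fun ij => split_coef ij.1 ij.2 x.1 x.2)).
rewrite mulr_sumr; apply: eq_bigr => i _; rewrite mulr_sumr.
by apply: eq_bigr => j _; rewrite mulrA [volume _ _ * _]mulrC.
Qed.

Lemma lex_schemesP k P :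
  reflect (P \in schemes I /\
           forall j, (j < k)%N -> sorted_load j P = lex_load I j)
          (P \in lex_schemes I k).
Proof.
elim: k => [|k IH] /=; first by apply: (iffP idP) => [|[]].
rewrite [X in reflect _ X]inE; apply: (iffP andP) => [[/IH[PF Pk] /eqP Pk1]|[PF Pk]].
  by split=> // j; rewrite ltnS leq_eqVlt => /predU1P[->|/Pk].
split; last by apply/eqP/Pk.
by apply/IH; split=> // j jk; apply/Pk/ltnW.
Qed.

Lemma lex_schemes_neq0 k : schemes I != set0 -> lex_schemes I k != set0.
Proof.
move=> F0; elim: k => //= k /(min_overP (@sorted_load I k))[[P Pk Pmin] _].
by apply/set0Pn; exists P; rewrite inE Pk Pmin eqxx.
Qed.

(** Sorting the pairs instead of their loads records which pair holds each rank, with ties resolved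
    by the sort. *)
Definition sorted_arc_times P : seq (Defs.arc I * time I) :=
  sort (relpre (load P) >=%O) (enum (arc_times I)).

Lemma mem_sorted_arc_times P x : (x \in sorted_arc_times P) = (x \in arc_times I).
Proof. by rewrite mem_sort mem_enum. Qed.

Lemma uniq_sorted_arc_times P : uniq (sorted_arc_times P).
Proof. by rewrite sort_uniq enum_uniq. Qed.

Lemma size_sorted_arc_times P : size (sorted_arc_times P) = num_arc_times I.
Proof. by rewrite size_sort -cardE. Qed.

Lemma sorted_loadE k P :
  sorted_load k P = nth 0 [seq load P x | x <- sorted_arc_times P] k.
Proof. by rewrite /sorted_load sort_map. Qed.

Lemma sorted_load_mem P (r : rank I) :
  exists2 x, x \in arc_times I & sorted_load r P = load P x.
Proof.
have r_lt : (r < size [seq load P x | x <- sorted_arc_times P])%N.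
  by rewrite size_map size_sorted_arc_times.
have /mapP[x xA xr] := mem_nth 0 r_lt.
by exists x; rewrite ?sorted_loadE // -(mem_sorted_arc_times P).
Qed.

End Loads.

Section Program.
Variables (I : asr_instance) (R : realFieldType).

(** A choice [f] of one pair per rank is a bijection along which [L_var s] agrees with the loads; a
    non-increasing rearrangement of the loads is unique. *)
Lemma feasible_L (k : rank I) (s : mip_point I R) :
  feasible k s -> forall r, L_var s r = ratr (sorted_load r (scheme_var s)).
Proof.
move=> fs r; set P := scheme_var s.
have /fin_all_exists2[f fA pi1] r' :
    exists2 x, x \in arc_times I & pi_var s x r' = 1.
  by apply: sum01_eq1_exists (one_arc fs r') => x /(pi_binary fs).
have f_inj : injective f.
  move=> r1 r2 e; apply: (sum01_eq1_unique _ (one_rank fs (fA r1)) (pi1 r1)).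
    by move=> r'; apply: (pi_binary fs).
  by rewrite e pi1.
have Lf r' : L_var s r' = ratr (load P (f r')).
  (* Where [pi_var] is 1 the big-M slack vanishes, and the two inequalities give equality. *)
  have := L_le fs r' (fA r'); have := L_ge fs r' (fA r').
  by rewrite pi1 subrr mulr0 -/P; lra.
pose Ls := [seq L_var s r' | r' <- enum 'I_(num_arc_times I)].
have LsE (r' : rank I) : Ls`_r' = L_var s r'.
  by rewrite (nth_map r') ?size_enum_ord // nth_ord_enum.
pose ls : seq R := [seq ratr (load P x) | x <- sorted_arc_times P].
have perm_f : perm_eq [seq f r' | r' <- enum 'I_(num_arc_times I)]
                      (sorted_arc_times P).
  have uniq_f : uniq [seq f r' | r' <- enum 'I_(num_arc_times I)].
    by rewrite map_inj_uniq ?enum_uniq.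
  have sub_f : {subset [seq f r' | r' <- enum 'I_(num_arc_times I)]
                <= sorted_arc_times P}.
    by move=> _ /mapP[r' _ ->]; rewrite mem_sorted_arc_times.
  apply: uniq_perm => //; first exact: uniq_sorted_arc_times.
  (* There are as many ranks as pairs, so the injection [f] is onto. *)
  have size_f : (size (sorted_arc_times P) <=
                 size [seq f r' | r' <- enum 'I_(num_arc_times I)])%N.
    by rewrite size_sorted_arc_times size_map size_enum_ord.
  by have [_ eq_f] := uniq_min_size uniq_f sub_f size_f.
have perm_L : perm_eq Ls ls.
  rewrite /Ls (eq_map Lf) (map_comp (fun x => ratr (load P x)) f).
  exact: perm_map.
have sorted_ls : sorted >=%O ls.
  rewrite sorted_map (eq_sorted (e' := relpre (load P) >=%O)).
    by apply: sort_sorted => x y; apply: le_total.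
  by move=> x y /=; rewrite ler_rat.
have sorted_Ls : sorted >=%O Ls.
  apply/(sortedP 0) => i; rewrite size_map size_enum_ord => i1.
  have := L_sorted fs (erefl : val (Ordinal i1) = (Ordinal (ltnW i1)).+1).
  by rewrite -!LsE.
have := sorted_eq ge_trans ge_anti sorted_Ls sorted_ls perm_L.
move/(congr1 (nth 0 ^~ r)); rewrite LsE => ->.
rewrite sorted_loadE /ls (map_comp ratr (load P)) (nth_map 0) //.
by rewrite size_map size_sorted_arc_times.
Qed.

Definition sorted_point (P : scheme I) : mip_point I R :=
  MipPoint P (fun x r => (index x (sorted_arc_times P) == r)%:R)
           (fun r => ratr (sorted_load r P)).

Lemma feasible_sorted_point (k : rank I) (P : scheme I) :
  P \in lex_schemes I k -> feasible k (sorted_point P).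
Proof.
case/lex_schemesP => PF Pk.
(* Loads lie between 0 and [bigM I], so any two differ by at most [bigM I]; this covers the big-M
   constraints where [pi_var] is 0. *)
have bound x y : x \in arc_times I ->
    ratr (load P x) - ratr (load P y) <= ratr (bigM I) :> R.
  move=> xA; rewrite -rmorphB ler_rat lerBlDr.
  by rewrite (le_trans (load_le_bigM PF xA)) // lerDl load_ge0.
have assigned x (r : rank I) : x \in arc_times I ->
    index x (sorted_arc_times P) == r -> sorted_load r P = load P x.
  rewrite -(mem_sorted_arc_times P) => xs /eqP <-.
  by rewrite sorted_loadE (nth_map x) ?index_mem // nth_index.
split=> //= [x xA|r|x r xA|x r xA|r r' rr'|j jk|x r _|r].
- have xr : (index x (sorted_arc_times P) < num_arc_times I)%N.
    by rewrite -(size_sorted_arc_times P) index_mem mem_sorted_arc_times.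
  rewrite (bigD1 (Ordinal xr)) //= eqxx big1 ?addr0 // => r /negbTE rD.
  by move: rD; rewrite -val_eqE eq_sym /= => ->.
- have [x0 _ _] := sorted_load_mem P r.
  have r_lt : (r < size (sorted_arc_times P))%N by rewrite size_sorted_arc_times.
  have xA : nth x0 (sorted_arc_times P) r \in arc_times I.
    by rewrite -(mem_sorted_arc_times P) mem_nth.
  rewrite (bigD1 _ xA) /= index_uniq ?uniq_sorted_arc_times // eqxx.
  rewrite big1 ?addr0 // => x /andP[xA' xD]; case: eqP => // xr; case/negP: xD.
  by rewrite -xr nth_index ?mem_sorted_arc_times.
- have [/(assigned _ _ xA) ->|_] := boolP (_ == _); first by rewrite !subrr mulr0.
  by have [y yA ->] := sorted_load_mem P r; rewrite subr0 mulr1 bound.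
- have [/(assigned _ _ xA) ->|_] := boolP (_ == _); first by rewrite !subrr mulr0.
  by have [y yA ->] := sorted_load_mem P r; rewrite subr0 mulr1 bound.
- rewrite ler_rat rr' /sorted_load.
  have /(sortedP 0) := sort_sorted (fun x y : rat => le_total y x)
    [seq load P x | x <- enum (arc_times I)].
  by apply; rewrite size_sort size_map -cardE -rr'.
- by rewrite Pk.
- by case: (_ == _); [right | left].
- by have [y _ ->] := sorted_load_mem P r; rewrite ler0q load_ge0.
Qed.

Lemma feasible_lex_schemes (k : rank I) (s : mip_point I R) :
  feasible k s -> scheme_var s \in lex_schemes I k.
Proof.
move=> fs; apply/lex_schemesP; split; first exact: (scheme_ok fs).
move=> j jk; have jN := ltn_trans jk (ltn_ord k).
(* The fixed values become equalities of embedded rationals, and [ratr] is injective. *)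
have := L_fixed fs (jk : (Ordinal jN < k)%N); rewrite (feasible_L fs).
exact: fmorph_inj.
Qed.

End Program.

Theorem theorem1 (I : asr_instance) (R : realFieldType)
    (F_nonempty : schemes I != set0) (k : rank I) :
  optimal_value k (ratr (lex_load I k) : R) /\
  forall s : mip_point I R, optimal k s -> scheme_var s \in lex_schemes I k.+1.
Proof.
(* [P] attains [lex_load I k]. Ranks count from 0, so [lex_schemes I k] holds the schemes optimal at
   all ranks before [k], and [k.+1] adds rank [k] itself. *)
have [[P Pk Pmin] lex_min] :=
  min_overP (@sorted_load I k) (lex_schemes_neq0 k F_nonempty).
have fP := feasible_sorted_point R Pk.
have lower (s : mip_point I R) : feasible k s -> ratr (lex_load I k) <= L_var s k.
  by move=> fs; rewrite (feasible_L fs) ler_rat lex_min ?feasible_lex_schemes.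
split.
  exists (sorted_point R P); last by rewrite /= Pmin.
  by split=> // s /lower; rewrite /= Pmin.
(* Comparison with [sorted_point R P] bounds the load of rank [k] from above by [lex_load I k];
   [lex_min] gives the reverse. *)
move=> s [fs /(_ _ fP)]; rewrite /= Pmin (feasible_L fs) ler_rat => le_min.
rewrite inE feasible_lex_schemes //=.
by rewrite eq_le le_min lex_min ?feasible_lex_schemes.
Qed.
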